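(* Let $z,d\in\mathbb{Z}_{>0}$, $\mathbf{k}=(k_1,\dots,k_d)\in\mathbb{Z}_{>0}^d$, and let $j_1,j_2$ be integers with $1\le j_1\le j_2\le d$. Put $\mathbf{k}_{(1;j_1)}=(k_1,\dots,k_{j_1})$, $\mathbf{k}_{(j_1+1;j_2)}=(k_{j_1+1},\dots,k_{j_2})$, $\mathbf{k}_{(j_2+1;d)}=(k_{j_2+1},\dots,k_d)$ (an index is empty if its lower bound exceeds its upper bound). Then $$\zeta_q^{\mathrm f}\Big(u_{\mathbf{k}_{(1;j_1)}}\big(u_{\mathbf{k}_{(j_1+1;j_2)}}\ast u_{\mathbf{k}_{(j_2+1;d)}}u_0^z\big)\Big)\in\sum_{s=1}^z \mathrm{Fil}^{\mathrm{Z,D,W}}_{z-s,\,d+s,\,w}\mathcal{Z}_q^f,$$ where $w=k_1+\cdots+k_d+z$.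
   Context: Let $\mathcal{U}=\{u_j\mid j\in\mathbb{Z}_{\ge0}\}$ and let $\mathbb{Q}\langle\mathcal{U}\rangle$ be the $\mathbb{Q}$-vector space spanned by words in $\mathcal{U}$ (empty word $\mathbf 1$), with concatenation. For an index $\mathbf{k}=(k_1,\dots,k_r)$ write $u_{\mathbf{k}}=u_{k_1}\cdots u_{k_r}$ and $u_\emptyset=\mathbf 1$. The stuffle product $\ast$ on $\mathbb{Q}\langle\mathcal{U}\rangle$ is the $\mathbb{Q}$-bilinear product with $\mathbf 1\ast W=W\ast\mathbf 1=W$ and $u_{a}W_1\ast u_{b}W_2=u_{a}(W_1\ast u_{b}W_2)+u_{b}(u_{a}W_1\ast W_2)+u_{a+b}(W_1\ast W_2)$ for all $a,b\ge 0$ and words $W_1,W_2$; it is commutative and associative. For a word $W=u_{k_1}\cdots u_{k_r}$: $\mathrm{dep}(W)=\#\{j: k_j\ne0\}$, $\mathrm{zero}(W)=\#\{j:k_j=0\}$, $\mathrm{wt}(W)=k_1+\cdots+k_r+\mathrm{zero}(W)$. $\mathcal{U}^{\ast,\circ}$ is the set of words not starting with $u_0$ (including $\mathbf 1$), and $\mathbb{Q}\langle\mathcal{U}\rangle^\circ$ is its $\mathbb{Q}$-span, a subalgebra for $\ast$. The $\mathbb{Q}$-linear involution $\tau$ of $\mathbb{Q}\langle\mathcal{U}\rangle^\circ$ is given by $\tau(\mathbf 1)=\mathbf 1$ and $\tau(u_{k_1}u_0^{z_1}\cdots u_{k_d}u_0^{z_d})=u_{z_d+1}u_0^{k_d-1}\cdots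 u_{z_1+1}u_0^{k_1-1}$ for $d\ge 1$, $k_i\ge1$, $z_i\ge0$. Let $T$ be the ideal of $(\mathbb{Q}\langle\mathcal{U}\rangle^\circ,\ast)$ generated by all $\tau(W)-W$, $W\in\mathbb{Q}\langle\mathcal{U}\rangle^\circ$. The algebra of formal multiple $q$-zeta values is $\mathcal{Z}_q^f=(\mathbb{Q}\langle\mathcal{U}\rangle^\circ,\ast)/T$, and $\zeta_q^{\mathrm f}(W)$ denotes the class of $W$. For an integer $n$, let $\mathrm{Fil}^{\mathrm Z}_n\mathcal{Z}_q^f$, $\mathrm{Fil}^{\mathrm D}_n\mathcal{Z}_q^f$, $\mathrm{Fil}^{\mathrm W}_n\mathcal{Z}_q^f$ be the $\mathbb{Q}$-spans of all $\zeta_q^{\mathrm f}(W)$ with $W\in\mathcal{U}^{\ast,\circ}$ and, respectively, $\mathrm{zero}(W)\le n$, $\mathrm{dep}(W)\le n$, $\mathrm{wt}(W)\le n$. For integers $z,d,w$ put $$\mathrm{Fil}^{\mathrm{Z,D,W}}_{z,d,w}\mathcal{Z}_q^f=\mathrm{Fil}^{\mathrm Z}_z\mathcal{Z}_q^f\cap\mathrm{Fil}^{\mathrm D}_d\mathcal{Z}_q^f\cap\mathrm{Fil}^{\mathrm W}_w\mathcal{Z}_q^f.$$ *)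

(* Defs.v *)
From HB Require Import structures.
From mathcomp Require Import all_boot all_order all_algebra.
From mathcomp Require Import generic_quotient ring_quotient finmap.
From mathcomp Require Import boolp classical_sets.
From mathcomp Require Import monalg.

Set Implicit Arguments.
Unset Strict Implicit.
Unset Printing Implicit Defensive.

Import GRing.Theory Num.Theory.

Local Open Scope ring_scope.

Lemma cat_eq_nil (T : Type) (s t : seq T) :
  s ++ t = [::] -> s = [::] /\ t = [::].
Proof. by case: s; case: t. Qed.

HB.instance Definition _ (T : choiceType) :=
  Choice_isMonomialDef.Build (seq T)
    (@catA T) (@cat0s T) (@cats0 T) (@cat_eq_nil T).

(* The ring product of [QU] is concatenation; the stuffle product is the
   separate operation [stuffle] below. *)
Notation QU := {malg rat[seq nat]}.

HB.lock Definition u (s : seq nat) : QU := << s >>.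

HB.lock Definition lin_ext (V : lmodType rat) (f : seq nat -> V) (x : QU) : V :=
  \sum_(w <- msupp x) x@_w *: f w.

Fixpoint stuffle_word (s : seq nat) : seq nat -> QU :=
  fix aux (t : seq nat) : QU :=
    match s, t with
    | [::], _ => u t
    | _, [::] => u s
    | a :: s', b :: t' =>
        u [:: a] * stuffle_word s' t + u [:: b] * aux t'
        + u [:: (a + b)%N] * stuffle_word s' t'
    end.

HB.lock Definition stuffle (x y : QU) : QU :=
  lin_ext (fun s => lin_ext (stuffle_word s) y) x.

Definition dep (s : seq nat) : nat := count (fun k => k != 0%N) s.
Definition zero (s : seq nat) : nat := count (fun k => k == 0%N) s.
Definition wt (s : seq nat) : nat := (sumn s + zero s)%N.

(* The default 1 makes the empty word admissible. *)
Definition admissible (s : seq nat) : bool := head 1%N s != 0%N.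

Definition QUo_pred : {pred QU} :=
  fun x => all (fun w : seq nat => admissible w) (msupp x).

Record QUo : predArgType := MkQUo { QUo_val : QU; _ : QUo_val \in QUo_pred }.

HB.instance Definition _ := [isSub for QUo_val].
HB.instance Definition _ := [Choice of QUo by <:].

(* The list [:: (k_1, z_1); ...; (k_d, z_d)] encodes the word
   u_{k_1} u_0^{z_1} ... u_{k_d} u_0^{z_d}. *)
Definition word_of_blocks (b : seq (nat * nat)) : seq nat :=
  flatten [seq p.1 :: nseq p.2 0%N | p <- b].

Definition dual_blocks (b : seq (nat * nat)) : seq (nat * nat) :=
  rev [seq (p.2.+1, p.1.-1) | p <- b].

Fixpoint blocks_aux (k z : nat) (s : seq nat) : seq (nat * nat) :=
  match s with
  | [::] => [:: (k, z)]
  | 0%N :: s' => blocks_aux k z.+1 s'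
  | k'.+1 :: s' => (k, z) :: blocks_aux k'.+1 0 s'
  end.

Definition blocks (s : seq nat) : seq (nat * nat) :=
  if s is k :: s' then blocks_aux k 0 s' else [::].

Definition tau_word (s : seq nat) : seq nat :=
  word_of_blocks (dual_blocks (blocks s)).

Lemma blocks_aux_nseq k z n b :
  all (fun p : nat * nat => 0 < p.1)%N b ->
  blocks_aux k z (nseq n 0%N ++ word_of_blocks b) = (k, (z + n)%N) :: b.
Proof.
elim: b k z n => [|[k' z'] b IH] k z n.
  move=> _; rewrite cats0.
  by elim: n z => [|n IHn] z /=; [rewrite addn0 | rewrite IHn addSnnS].
case/andP=> /= k'0 hb.
elim: n z => [|n IHn] z /=; last by rewrite IHn addSnnS.
by rewrite addn0; case: k' k'0 => // k' _; rewrite -[flatten _]/(word_of_blocks b) IH.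
Qed.

Lemma tau_wordE (b : seq (nat * nat)) :
  all (fun p : nat * nat => 0 < p.1)%N b ->
  tau_word (word_of_blocks b) = word_of_blocks (dual_blocks b).
Proof.
case: b => [|[k z] b] //= /andP[_ hb]; congr word_of_blocks; congr dual_blocks.
by rewrite /word_of_blocks /= -[flatten _]/(word_of_blocks b) blocks_aux_nseq.
Qed.

Lemma admissible_blocks s : admissible s ->
  exists2 b, all (fun p : nat * nat => 0 < p.1)%N b & s = word_of_blocks b.
Proof.
have aux r : exists n b, all (fun p : nat * nat => 0 < p.1)%N b /\
    r = nseq n 0%N ++ word_of_blocks b.
  elim: r => [|[|k] r [n [b [b0 ->]]]]; first by exists 0%N, [::].
    by exists n.+1, b.
  by exists 0%N, ((k.+1, n) :: b).
case: s => [|k s] hs; first by exists [::].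
have [n [b [b0 ->]]] := aux s; exists ((k, n) :: b) => //=.
by rewrite b0 lt0n andbT.
Qed.

Lemma tau_word_nil s : (tau_word s == [::]) = (s == [::]).
Proof.
case: s => [|k s] //=; rewrite /tau_word /blocks /dual_blocks.
have /(_ k 0%N) : forall k z, blocks_aux k z s != [::].
  by elim: s => [|[|m] s IH] k' z //=.
case: (blocks_aux k 0 s) => // p b _.
by rewrite /= rev_cons -cats1 /word_of_blocks map_cat flatten_cat; case: flatten.
Qed.

Lemma admissible_tau s : admissible (tau_word s).
Proof.
rewrite /tau_word; set b := blocks s; rewrite /dual_blocks -map_rev.
by case: (rev b) => [|p b'].
Qed.

Section LinExt.
Variables (V : lmodType rat) (f : seq nat -> V).

Lemma lin_extEw (d : {fset seq nat}) x : (msupp x `<=` d)%fset ->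
  lin_ext f x = \sum_(w <- d) x@_w *: f w.
Proof.
move=> le; rewrite lin_ext.unlock [LHS](big_fset_incl _ le) //= => w _ /mcoeff_outdom ->.
by rewrite scale0r.
Qed.

Lemma lin_ext_linear a x y : lin_ext f (a *: x + y) = a *: lin_ext f x + lin_ext f y.
Proof.
pose d := (msupp x `|` msupp y)%fset.
rewrite !(@lin_extEw d) ?fsubsetUl ?fsubsetUr //; last first.
  apply: fsubset_trans (msuppD_le _ _) _.
  by apply: fsetSU; apply: msuppZ_le.
rewrite scaler_sumr -big_split /=; apply: eq_bigr => w _.
by rewrite mcoeffD mcoeffZ scalerDl scalerA.
Qed.

HB.instance Definition _ :=
  GRing.isLinear.Build rat QU V *:%R (lin_ext f) lin_ext_linear.

Lemma lin_extE x : lin_ext f x = \sum_(w <- msupp x) x@_w *: f w.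
Proof. by rewrite lin_ext.unlock. Qed.

Lemma lin_extU s : lin_ext f (u s) = f s.
Proof. by rewrite lin_ext.unlock u.unlock msuppU1 big_seq_fset1 mcoeffUU scale1r. Qed.
End LinExt.

Lemma eq_lin_ext (V : lmodType rat) (f g : seq nat -> V) :
  f =1 g -> lin_ext f =1 lin_ext g.
Proof. by move=> fg x; rewrite lin_ext.unlock; apply: eq_bigr => w _; rewrite fg. Qed.

Lemma QU_ind (P : QU -> Prop) :
  P 0 -> (forall a x y, P x -> P y -> P (a *: x + y)) -> (forall s, P (u s)) ->
  forall x, P x.
Proof.
move=> P0 PD PU x; rewrite [x]monalgE.
elim/big_rec: _ => // w y _ Py.
have -> : << x@_w *g w >> = x@_w *: u w.
  rewrite u.unlock.
  apply/malgP => k; rewrite mcoeffZ !mcoeffU.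
  by case: eqP => _; rewrite ?mulr1 ?mulr0.
exact: PD.
Qed.

Lemma lin_extuE x : x = lin_ext u x.
Proof.
elim/QU_ind: x => [|a x y IHx IHy|s]; first by rewrite linear0.
  by rewrite lin_ext_linear -IHx -IHy.
by rewrite lin_extU.
Qed.

Lemma u_cat s t : u (s ++ t) = u s * u t.
Proof.
by rewrite u.unlock malgM_def fgmulUU mulr1.
Qed.

Lemma u_nil : u [::] = 1.
Proof. by rewrite u.unlock. Qed.

Lemma u_cons a s : u (a :: s) = u [:: a] * u s.
Proof. by rewrite -u_cat. Qed.

Lemma stuffle_lin_l a x y z : stuffle (a *: x + y) z = a *: stuffle x z + stuffle y z.
Proof. by rewrite stuffle.unlock linearP. Qed.

Lemma stuffle0l z : stuffle 0 z = 0.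
Proof. by rewrite stuffle.unlock linear0. Qed.

Lemma stuffle_lin_r a x y z : stuffle z (a *: x + y) = a *: stuffle z x + stuffle z y.
Proof.
elim/QU_ind: z => [|b z1 z2 IH1 IH2|s].
- by rewrite !stuffle0l scaler0 addr0.
- rewrite !stuffle_lin_l IH1 IH2 !scalerDr !scalerA [b * a]mulrC.
  by rewrite [LHS](AC (2*2) ((1*3)*(2*4))).
- by rewrite stuffle.unlock !lin_extU linearP.
Qed.

Lemma stuffleDl x y z : stuffle (x + y) z = stuffle x z + stuffle y z.
Proof. by rewrite stuffle.unlock linearD. Qed.
Lemma stuffleZl a x z : stuffle (a *: x) z = a *: stuffle x z.
Proof. by rewrite stuffle.unlock linearZ. Qed.
Lemma stuffleDr x y z : stuffle z (x + y) = stuffle z x + stuffle z y.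
Proof. by have := stuffle_lin_r 1 x y z; rewrite !scale1r. Qed.
Lemma stuffle0r z : stuffle z 0 = 0.
Proof. by have := stuffle_lin_r (-1) 0 0 z; rewrite scaler0 addr0 scaleN1r addNr. Qed.

Lemma stuffleU s t : stuffle (u s) (u t) = stuffle_word s t.
Proof. by rewrite stuffle.unlock !lin_extU. Qed.

Lemma stuffle1l y : stuffle (u [::]) y = y.
Proof.
elim/QU_ind: y => [|a x y IHx IHy|s]; first exact: stuffle0r.
  by rewrite stuffle_lin_r IHx IHy.
by rewrite stuffleU; case: s.
Qed.

Lemma stuffle1r x : stuffle x (u [::]) = x.
Proof.
elim/QU_ind: x => [|a x y IHx IHy|s]; first exact: stuffle0l.
  by rewrite stuffle_lin_l IHx IHy.
by rewrite stuffleU; case: s.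
Qed.

Lemma QU_scalerAr (c : rat) (x y : QU) : c *: (x * y) = x * (c *: y).
Proof.
apply/malgP => k; rewrite mcoeffZ mcoeffMl.
rewrite (mcoeffMlw _ (fsubset_refl _) (msuppZ_le c y)) mulr_sumr.
apply: eq_bigr => i _; rewrite mulr_sumr; apply: eq_bigr => j _.
by rewrite mcoeffZ mulrCA mulrnAr.
Qed.

Lemma stuffle_rec a b x y :
  stuffle (u [:: a] * x) (u [:: b] * y) =
    u [:: a] * stuffle x (u [:: b] * y) + u [:: b] * stuffle (u [:: a] * x) y
    + u [:: (a + b)%N] * stuffle x y.
Proof.
elim/QU_ind: x => [|c x1 x2 IH1 IH2|s].
- by rewrite !(mulr0, stuffle0l) !addr0.
- rewrite !mulrDr -!QU_scalerAr !stuffle_lin_l IH1 IH2 !(mulrDr, scalerDr) -!QU_scalerAr.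
  by rewrite [LHS](AC (3*3) ((1*4)*(2*5)*(3*6))).
elim/QU_ind: y => [|c y1 y2 IH1 IH2|t].
- by rewrite !(mulr0, stuffle0r) !addr0.
- rewrite !mulrDr -!QU_scalerAr !stuffle_lin_r IH1 IH2 !(mulrDr, scalerDr) -!QU_scalerAr.
  by rewrite [LHS](AC (3*3) ((1*4)*(2*5)*(3*6))).
by rewrite -!u_cons !stuffleU.
Qed.

Lemma stuffleC x y : stuffle x y = stuffle y x.
Proof.
elim/QU_ind: x => [|c x1 x2 IH1 IH2|s]; first by rewrite stuffle0l stuffle0r.
  by rewrite stuffle_lin_l stuffle_lin_r IH1 IH2.
elim/QU_ind: y => [|c y1 y2 IH1 IH2|t]; first by rewrite stuffle0l stuffle0r.
  by rewrite stuffle_lin_l stuffle_lin_r IH1 IH2.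
elim: s t => [|a s IHs] t; first by rewrite stuffle1l stuffle1r.
elim: t => [|b t IHt]; first by rewrite stuffle1l stuffle1r.
have IHt' : stuffle (u [:: a] * u s) (u t) = stuffle (u t) (u [:: a] * u s).
  by rewrite -u_cons IHt.
have IHs' : stuffle (u s) (u [:: b] * u t) = stuffle (u [:: b] * u t) (u s).
  by rewrite -u_cons IHs.
rewrite (u_cons a s) (u_cons b t) !stuffle_rec IHs' IHt' IHs (addnC a b).
by rewrite (addrC (u [:: a] * _) (u [:: b] * _)).
Qed.

Lemma sum9_l (V : zmodType) (x1 x2 x3 x4 x5 x6 x7 x8 x9 : V) :
  x1 + x2 + x3 + (x4 + x5 + x6) + (x7 + x8 + x9)
  = x1 + x4 + x7 + x2 + x5 + x3 + x6 + x8 + x9.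
Proof. by rewrite [LHS](AC (3*3*3) (1*4*7*2*5*3*6*8*9)). Qed.

Lemma sum9_r (V : zmodType) (x1 x2 x3 x4 x5 x6 x7 x8 x9 : V) :
  x1 + x4 + (x2 + x5 + x8) + x7 + x3 + x6 + x9
  = x1 + x2 + x3 + (x4 + x5 + x6) + (x7 + x8 + x9).
Proof. by rewrite [RHS](AC (3*3*3) (1*4*(2*5*8)*7*3*6*9)). Qed.

Lemma stuffleA x y z : stuffle x (stuffle y z) = stuffle (stuffle x y) z.
Proof.
elim/QU_ind: x => [|c x1 x2 IH1 IH2|s]; first by rewrite !stuffle0l.
  by rewrite !stuffle_lin_l IH1 IH2.
elim/QU_ind: y => [|c y1 y2 IH1 IH2|t]; first by rewrite !(stuffle0l, stuffle0r).
  by rewrite !(stuffle_lin_l, stuffle_lin_r) IH1 IH2.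
elim/QU_ind: z => [|c z1 z2 IH1 IH2|r]; first by rewrite !stuffle0r.
  by rewrite !stuffle_lin_r IH1 IH2.
elim: s t r => [|a A IHs] t r; first by rewrite !stuffle1l.
elim: t r => [|b B IHt] r; first by rewrite stuffle1l stuffle1r.
elim: r => [|c C IHr]; first by rewrite !stuffle1r.
have EX : u [:: a] * u A = u (a :: A) by rewrite -u_cons.
have EY : u [:: b] * u B = u (b :: B) by rewrite -u_cons.
have EZ : u [:: c] * u C = u (c :: C) by rewrite -u_cons.
have EXY : stuffle (u (a :: A)) (u (b :: B)) =
  u [:: a] * stuffle (u A) (u (b :: B)) + u [:: b] * stuffle (u (a :: A)) (u B)
  + u [:: (a + b)%N] * stuffle (u A) (u B) by rewrite -EX -EY; exact: stuffle_rec.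
have EYZ : stuffle (u (b :: B)) (u (c :: C)) =
  u [:: b] * stuffle (u B) (u (c :: C)) + u [:: c] * stuffle (u (b :: B)) (u C)
  + u [:: (b + c)%N] * stuffle (u B) (u C) by rewrite -EY -EZ; exact: stuffle_rec.
transitivity (u [:: a] * stuffle (u A) (stuffle (u (b :: B)) (u (c :: C)))
   + u [:: b] * stuffle (u (a :: A)) (stuffle (u B) (u (c :: C)))
   + u [:: c] * stuffle (u (a :: A)) (stuffle (u (b :: B)) (u C))
   + u [:: (a + b)%N] * stuffle (u A) (stuffle (u B) (u (c :: C)))
   + u [:: (a + c)%N] * stuffle (u A) (stuffle (u (b :: B)) (u C))
   + u [:: (b + c)%N] * stuffle (u (a :: A)) (stuffle (u B) (u C))
   + u [:: (a + b + c)%N] * stuffle (u A) (stuffle (u B) (u C))).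
  rewrite EYZ !stuffleDr -EX !stuffle_rec EX !mulrDr addnA.
  exact: sum9_l.
rewrite !IHs !IHt IHr.
rewrite EXY !stuffleDl -EZ !stuffle_rec EZ !mulrDr.
exact: sum9_r.
Qed.

Lemma QUoP x : reflect (forall w : seq nat, ~~ admissible w -> x@_w = 0) (x \in QUo_pred).
Proof.
apply: (iffP allP) => [h w|h w].
  by move=> hw; apply: mcoeff_outdom; apply: contra hw => /h.
by rewrite -mcoeff_neq0 => xw; apply: contraNT xw => /h ->.
Qed.

Lemma QUo_submod : submod_closed QUo_pred.
Proof.
split; first by apply/QUoP => w _; rewrite mcoeff0.
move=> a x y /QUoP hx /QUoP hy; apply/QUoP => w hw.
by rewrite mcoeffD mcoeffZ hx // hy // mulr0 addr0.
Qed.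

HB.instance Definition _ := GRing.isSubmodClosed.Build rat QU QUo_pred
  (GRing.submod_closed_semi QUo_submod).
HB.instance Definition _ := [SubChoice_isSubZmodule of QUo by <:].
HB.instance Definition _ := [SubZmodule_isSubLmodule of QUo by <:].

Lemma QUo_u s : admissible s -> u s \in QUo_pred.
Proof.
move=> hs; apply/QUoP => w hw; rewrite u.unlock mcoeffU.
by case: eqP hw => // <-; rewrite hs.
Qed.

Lemma QUo_ucat a x : a != 0%N -> u [:: a] * x \in QUo_pred.
Proof.
move=> a0; elim/QU_ind: x => [|c x y IHx IHy|s]; first by rewrite mulr0 rpred0.
  by rewrite mulrDr -QU_scalerAr rpredD // rpredZ.
by rewrite -u_cons QUo_u.
Qed.

Lemma lin_ext_closed (S : submodClosed QU) (f : seq nat -> QU) x :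
  x \in QUo_pred -> (forall s, admissible s -> f s \in S) -> lin_ext f x \in S.
Proof.
move=> /allP hx hf; rewrite lin_ext.unlock big_seq.
by apply: rpred_sum => w hw; rewrite rpredZ // hf // hx.
Qed.

Lemma QUo_stuffle x y :
  x \in QUo_pred -> y \in QUo_pred -> stuffle x y \in QUo_pred.
Proof.
move=> hx hy; rewrite stuffle.unlock; apply: lin_ext_closed hx _ => s hs.
apply: lin_ext_closed hy _ => t ht; rewrite -stuffleU.
case: s hs => [|a s] hs; first by rewrite stuffle1l QUo_u.
case: t ht => [|b t] ht; first by rewrite stuffle1r QUo_u.
rewrite (u_cons a) (u_cons b) stuffle_rec.
by rewrite !rpredD ?QUo_ucat // addn_eq0 negb_and (hs : a != 0%N).
Qed.

Definition QUo_of_word (s : seq nat) (hs : admissible s) : QUo := MkQUo (QUo_u hs).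

Definition QUo_mul (x y : QUo) : QUo := MkQUo (QUo_stuffle (valP x) (valP y)).
Definition QUo_one : QUo := QUo_of_word (erefl : admissible [::]).

Lemma QUo_mulA : associative QUo_mul.
Proof. by move=> x y z; apply: val_inj; exact: stuffleA. Qed.
Lemma QUo_mulC : commutative QUo_mul.
Proof. by move=> x y; apply: val_inj; exact: stuffleC. Qed.
Lemma QUo_mul1 : left_id QUo_one QUo_mul.
Proof. by move=> x; apply: val_inj; exact: stuffle1l. Qed.
Lemma QUo_mulDl : left_distributive QUo_mul +%R.
Proof. by move=> x y z; apply: val_inj; exact: stuffleDl. Qed.
Lemma QUo_one_neq0 : QUo_one != 0.
Proof.
apply/eqP => /(congr1 (fun x : QUo => (val x)@_[::])) /=.
by rewrite u.unlock mcoeffUU mcoeff0.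
Qed.

(* The algebra structure of [QUo] is the one of the stuffle product. *)
HB.instance Definition _ := GRing.Zmodule_isComNzRing.Build QUo
  QUo_mulA QUo_mulC QUo_mul1 QUo_mulDl QUo_one_neq0.

Lemma QUo_scaleAl (a : rat) (x y : QUo) : a *: (x * y) = (a *: x) * y.
Proof. by apply: val_inj; rewrite /= stuffleZl. Qed.

HB.instance Definition _ := GRing.Lmodule_isLalgebra.Build rat QUo QUo_scaleAl.
HB.instance Definition _ := GRing.Lalgebra_isComAlgebra.Build rat QUo.

Lemma QUo_tau (x : QUo) : lin_ext (fun s => u (tau_word s)) (val x) \in QUo_pred.
Proof.
apply: lin_ext_closed (valP x) _ => s _.
exact: QUo_u (admissible_tau s).
Qed.

Definition tau (x : QUo) : QUo := MkQUo (QUo_tau x).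

Lemma tau_blocks (b : seq (nat * nat)) (hb : admissible (word_of_blocks b)) :
  all (fun p : nat * nat => 0 < p.1)%N b ->
  val (tau (QUo_of_word hb)) = u (word_of_blocks (dual_blocks b)).
Proof. by move=> b0; rewrite /= lin_extU tau_wordE. Qed.

Lemma tau_linear : linear tau.
Proof. by move=> a x y; apply: val_inj; exact: linearP. Qed.

HB.instance Definition _ := GRing.isLinear.Build rat QUo QUo *:%R tau tau_linear.

Lemma tau_wordK s : admissible s -> tau_word (tau_word s) = s.
Proof.
move=> /admissible_blocks[b b0 ->].
rewrite !tau_wordE //; last first.
  by rewrite /dual_blocks all_rev all_map; apply/allP.
congr word_of_blocks; rewrite /dual_blocks map_rev revK -map_comp map_id_in //.
by move=> [k z] /(allP b0); case: k.
Qed.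

Lemma tauK : involutive tau.
Proof.
move=> x; apply: val_inj; rewrite /=; have := valP x; rewrite /=.
move: (QUo_val x) => y /allP hy.
rewrite [RHS](lin_extuE y) !(lin_extE _ y) linear_sum big_seq [RHS]big_seq.
apply: eq_bigr => s /hy hs.
by rewrite linearZ /= lin_extU tau_wordK.
Qed.

Lemma coef_u_nil s : (u s)@_[::] = (s == [::])%:R.
Proof. by rewrite u.unlock mcoeffU eq_sym. Qed.

Lemma coef_ucons_nil a (x : QU) : (u [:: a] * x)@_[::] = 0.
Proof.
elim/QU_ind: x => [|c x y IHx IHy|s]; first by rewrite mulr0 mcoeff0.
  by rewrite mulrDr -QU_scalerAr mcoeffD mcoeffZ IHx IHy mulr0 addr0.
by rewrite -u_cons coef_u_nil.
Qed.

Lemma coef_stuffle_nil x y : (stuffle x y)@_[::] = x@_[::] * y@_[::].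
Proof.
elim/QU_ind: x => [|c x1 x2 IH1 IH2|s].
- by rewrite stuffle0l mcoeff0 mul0r.
- by rewrite stuffle_lin_l !mcoeffD !mcoeffZ IH1 IH2 mulrDl mulrA.
elim/QU_ind: y => [|c y1 y2 IH1 IH2|t].
- by rewrite stuffle0r mcoeff0 mulr0.
- by rewrite stuffle_lin_r !mcoeffD !mcoeffZ IH1 IH2 mulrDr mulrCA.
case: s => [|a s]; first by rewrite stuffle1l (coef_u_nil [::]) mul1r.
case: t => [|b t]; first by rewrite stuffle1r (coef_u_nil [::]) mulr1.
by rewrite (u_cons a) (u_cons b) stuffle_rec !mcoeffD !coef_ucons_nil mul0r !addr0.
Qed.

Lemma coef_tau_nil (x : QUo) : (val (tau x))@_[::] = (val x)@_[::].
Proof.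
rewrite /=; elim/QU_ind: (QUo_val x) => [|c y z IHy IHz|s].
- by rewrite linear0.
- by rewrite linearP !mcoeffD !mcoeffZ IHy IHz.
by rewrite lin_extU !coef_u_nil tau_word_nil.
Qed.

(* [QUo] is commutative and unital, so the ideal generated by the tau W - W
   consists of their finite [QUo]-linear combinations. *)
Definition T_pred : {pred QUo} := fun x =>
  `[< exists r : seq (QUo * QUo), x = \sum_(p <- r) p.1 * (tau p.2 - p.2) >].

Lemma T_idealr_closed : idealr_closed T_pred.
Proof.
split.
- by apply/asboolP; exists [::]; rewrite big_nil.
- apply/negP => /asboolP[r] /(congr1 (fun x : QUo => (val x)@_[::])).
  suff -> : (val (\sum_(p <- r) p.1 * (tau p.2 - p.2)))@_[::] = 0.
    by move/eqP; rewrite /= coef_u_nil oner_eq0.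
  elim/big_rec: _ => [|p x _ IH]; first exact: (mcoeff0 [::]).
  rewrite [LHS](mcoeffD [::] (val (p.1 * _)) (val x)) IH addr0.
  rewrite [LHS](coef_stuffle_nil (val p.1) (val (tau p.2 - p.2))).
  rewrite [X in _ * X](mcoeffB [::] (val (tau p.2)) (val p.2)).
  by rewrite coef_tau_nil subrr mulr0.
- move=> a x y /asboolP[r ->] /asboolP[q ->]; apply/asboolP.
  exists ([seq (a * p.1, p.2) | p <- r] ++ q).
  rewrite big_cat big_map mulr_sumr; congr (_ + _).
  by apply: eq_bigr => p _; rewrite mulrA.
Qed.

HB.instance Definition _ := isIdealr.Build QUo T_pred T_idealr_closed.

Definition Zqf : Type := {ideal_quot T_pred}.

HB.instance Definition _ := GRing.ComNzRing.on Zqf.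

Definition zetaqf (x : QUo) : Zqf := (\pi_({ideal_quot T_pred}) x)%qT.

Lemma zetaqf_zmod_morphism : zmod_morphism zetaqf.
Proof. exact: pi_is_zmod_morphism. Qed.
Lemma zetaqf_monoid_morphism : monoid_morphism zetaqf.
Proof. exact: pi_is_monoid_morphism. Qed.

HB.instance Definition _ :=
  GRing.isZmodMorphism.Build QUo Zqf zetaqf zetaqf_zmod_morphism.
HB.instance Definition _ :=
  GRing.isMonoidMorphism.Build QUo Zqf zetaqf zetaqf_monoid_morphism.

Lemma zetaqf_eq x y : reflect (zetaqf x = zetaqf y) (x - y \in T_pred).
Proof. by rewrite Quotient.idealrBE; apply: eqP. Qed.

Definition Zqf_scale (a : rat) (x : Zqf) : Zqf := zetaqf a%:A * x.

Lemma Zqf_scaleA a b x : Zqf_scale a (Zqf_scale b x) = Zqf_scale (a * b) x.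
Proof. by rewrite /Zqf_scale mulrA -rmorphM -scalerAl mul1r scalerA. Qed.
Lemma Zqf_scale1 : left_id 1 Zqf_scale.
Proof. by move=> x; rewrite /Zqf_scale scale1r rmorph1 mul1r. Qed.
Lemma Zqf_scaleDr : right_distributive Zqf_scale +%R.
Proof. by move=> a x y; rewrite /Zqf_scale mulrDr. Qed.
Lemma Zqf_scaleDl x : {morph Zqf_scale^~ x : a b / a + b}.
Proof. by move=> a b; rewrite /Zqf_scale scalerDl rmorphD mulrDl. Qed.

HB.instance Definition _ := GRing.Zmodule_isLmodule.Build rat Zqf
  Zqf_scaleA Zqf_scale1 Zqf_scaleDr Zqf_scaleDl.

Lemma Zqf_scaleAl (a : rat) (x y : Zqf) : a *: (x * y) = (a *: x) * y.
Proof. exact: mulrA. Qed.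

HB.instance Definition _ := GRing.Lmodule_isLalgebra.Build rat Zqf Zqf_scaleAl.
HB.instance Definition _ := GRing.Lalgebra_isComAlgebra.Build rat Zqf.

Lemma zetaqf_scalable : scalable zetaqf.
Proof. by move=> a x; rewrite -{1}[x]mul1r scalerAl rmorphM. Qed.

HB.instance Definition _ :=
  GRing.isScalable.Build rat QUo Zqf *:%R zetaqf zetaqf_scalable.

Local Open Scope classical_set_scope.

Definition span (V : lmodType rat) (S : set V) : set V :=
  [set x | exists2 r : seq (rat * V),
     {in r, forall p, S p.2} & x = \sum_(p <- r) p.1 *: p.2].

Definition fil (f : seq nat -> nat) (n : int) : set Zqf :=
  span [set x | exists (s : seq nat) (hs : admissible s),
    (f s)%:Z <= n /\ x = zetaqf (QUo_of_word hs)].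

Definition FilZ : int -> set Zqf := fil zero.
Definition FilD : int -> set Zqf := fil dep.
Definition FilW : int -> set Zqf := fil wt.

Definition FilZDW (z d w : int) : set Zqf := FilZ z `&` FilD d `&` FilW w.

(* F m + ... + F n, both ends included. *)
Definition sum_subspaces (V : lmodType rat) (m n : nat) (F : nat -> set V) : set V :=
  [set x | exists2 y : nat -> V,
     forall s, (m <= s <= n)%N -> F s (y s) & x = \sum_(m <= s < n.+1) y s].

(* Main.v *)
From HB Require Import structures.
From mathcomp Require Import all_boot all_order all_algebra finmap.
From mathcomp Require Import boolp classical_sets monalg.
From mathcomp Require Import zify.
Require Import Defs.

Set Implicit Arguments.
Unset Strict Implicit.
Unset Printing Implicit Defensive.

Import Order.TTheory GRing.Theory Num.Theory.
Local Open Scope ring_scope.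

(** The relations tau W = W let one trade zeros for depth: if an admissible word
    W has depth e, then tau W has depth e, exactly [sumn W - e] zeros and the
    same weight.  A word is therefore good, that is, its class obviously lies in
    the target sum of filtrations (called [reduced] below), as soon as its dual
    has the prescribed letter sum [z + d], not too many zeros, and depth greater
    than [d].

    Take first one prefix letter and all zeros inserted behind it: the element
    u_a (u_B * u_0^z), with k = (a, B) of length d.  For a word l in positive
    letters with letter sum z, the product [u l * u (tau k)] has the same class
    as [u (tau l) * u k], where tau l has depth s and z - s zeros if l has s
    letters; this class is reduced.  On the other hand, the stuffle product of l
    with tau k consists of words with letter sum z + d and depth at least d.
    Those of depth > d are good, and depth d forces every letter of l to
    be merged into one of the d nonzero letters of tau k, all equal to 1.  Summed
    over all compositions l of z, the words of depth d are the duals of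
    u_{k_1} u_0^{c_1} ... u_{k_d} u_0^{c_d} with c_1 + ... + c_d = z
    ([comp_stuffle_unit_blocks]), so the sum of the latter is reduced
    ([insert_zeros_reduced]).  That sum is u_a (u_B * u_0^z) up to words in which
    a zero was absorbed by a letter of B, and those have fewer than z zeros
    ([stuffle_zeros]).

    The general element u_p (u_B * u_D u_0^z) follows by induction on d
    ([split_stuffle_reduced]).  The recursion of the stuffle product, read modulo
    words with a merged letter (of depth d - 1, hence covered by induction), says
      u_p (u_{bB} * u_{aD} u_0^z) =
        u_{pb} (u_B * u_{aD} u_0^z) + u_{pa} (u_{bB} * u_D u_0^z).
    For empty p, the left side is the product of u_{bB} with a reduced class of
    smaller depth, so it is reduced, and induction on D gives all prefixes of one
    letter, starting from the case D empty above.  If the claim is known for all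
    B and D with a nonempty prefix p, the left side is reduced again, and
    induction on B gives the prefixes pa: it starts at B empty, where
    u_{pa} u_D u_0^z is the element with prefix p and second factor aD. *)

(** * Elements supported on a set of words *)

Definition supported (P : pred (seq nat)) : {pred QU} :=
  fun x => all P (msupp x).

Lemma supported_submod P : submod_closed (supported P).
Proof.
have supP x : reflect (forall w : seq nat, ~~ P w -> x@_w = 0) (x \in supported P).
  apply: (iffP allP) => [h w hw|h w].
    by apply: mcoeff_outdom; apply: contra hw => /h.
  by rewrite -mcoeff_neq0 => xw; apply: contraNT xw => /h ->.
split; first by apply/supP => w _; rewrite mcoeff0.
move=> a x y /supP hx /supP hy; apply/supP => w hw.
by rewrite mcoeffD mcoeffZ hx // hy // mulr0 addr0.
Qed.

HB.instance Definition _ (P : pred (seq nat)) :=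
  GRing.isSubmodClosed.Build rat QU (supported P)
    (GRing.submod_closed_semi (supported_submod P)).

Lemma supported_u (P : pred (seq nat)) w : P w -> u w \in supported P.
Proof.
move=> Pw; rewrite unfold_in u.unlock msuppU1.
by apply/allP => v; rewrite in_fset1 => /eqP ->.
Qed.

Lemma supported_ind (P : pred (seq nat)) (Q : QU -> Prop) :
  Q 0 -> (forall a x y, Q x -> Q y -> Q (a *: x + y)) ->
  (forall w, P w -> Q (u w)) -> forall x, x \in supported P -> Q x.
Proof.
move=> Q0 QD Qu x /allP Px; rewrite (lin_extuE x) lin_extE big_seq.
by elim/big_rec: _ => // w y /Px Pw Qy; apply: QD => //; apply: Qu.
Qed.

Lemma supported_sub (P Q : pred (seq nat)) x :
  (forall w, P w -> Q w) -> x \in supported P -> x \in supported Q.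
Proof. by move=> PQ; apply: sub_all. Qed.

Lemma supported_and (P Q : pred (seq nat)) x :
  x \in supported P -> x \in supported Q ->
  x \in supported (fun w => P w && Q w).
Proof. by rewrite !unfold_in => hP hQ; rewrite -[all _ _]/(all (predI P Q) _) all_predI hP. Qed.

Lemma supported_mulu (P Q : pred (seq nat)) p x :
  (forall w, P w -> Q (p ++ w)) -> x \in supported P -> u p * x \in supported Q.
Proof.
move=> PQ; move: x; apply: supported_ind => [|a x y hx hy|w Pw].
- by rewrite mulr0 rpred0.
- by rewrite mulrDr -QU_scalerAr rpredD // rpredZ.
- by rewrite -u_cat supported_u // PQ.
Qed.

(** The last bound is the essential one: a nonzero letter of [t] either survives
    or is absorbed into a nonzero letter. *)
Definition stuffle_stat (s t w : seq nat) : bool :=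
  [&& sumn w == (sumn s + sumn t)%N, (zero w <= zero s + zero t)%N,
      (dep w <= dep s + dep t)%N & (dep t <= dep w)%N].

Lemma stuffle_stats s t : stuffle (u s) (u t) \in supported (stuffle_stat s t).
Proof.
elim: s t => [|a s IHs] t.
  by rewrite stuffle1l supported_u // /stuffle_stat !leqnn eqxx.
elim: t => [|b t IHt].
  by rewrite stuffle1r supported_u // /stuffle_stat /= !addn0 !leqnn eqxx.
rewrite (u_cons a) (u_cons b) stuffle_rec -!u_cons !rpredD //.
- apply: supported_mulu (IHs (b :: t)) => w; rewrite /stuffle_stat /dep /zero /=; lia.
- apply: supported_mulu IHt => w; rewrite /stuffle_stat /dep /zero /=; lia.
- apply: supported_mulu (IHs t) => w; rewrite /stuffle_stat /dep /zero /=; lia.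
Qed.

(** * The class of an arbitrary element *)

(** Extending the quotient map by 0 on words that are not admissible makes it
    linear on all of [QU], which spares membership proofs. *)
Definition admissible_part : QU -> QUo := lin_ext (fun s => insubd 0 (u s)).
HB.instance Definition _ := GRing.Linear.on admissible_part.

Lemma val_admissible_part x : x \in QUo_pred -> val (admissible_part x) = x.
Proof.
move: x; apply: supported_ind => [|a x y hx hy|w hw].
- by rewrite linear0.
- by rewrite linearP /= -[X in _ = a *: X + _]hx -[X in _ = _ + X]hy.
- by rewrite /admissible_part lin_extU insubdK // QUo_u.
Qed.

Definition zetaw (x : QU) : Zqf := zetaqf (admissible_part x).

Lemma zetaw_linear : linear zetaw.
Proof. by move=> a x y; rewrite /zetaw !linearP. Qed.
HB.instance Definition _ := GRing.isLinear.Build rat QU Zqf *:%R zetaw zetaw_linear.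

Lemma zetaw_u s (hs : admissible s) : zetaw (u s) = zetaqf (QUo_of_word hs).
Proof.
by congr zetaqf; apply: val_inj; rewrite val_admissible_part //= QUo_u.
Qed.

Lemma zetaw_stuffle x y : x \in QUo_pred -> y \in QUo_pred ->
  zetaw (stuffle x y) = zetaw x * zetaw y.
Proof.
move=> hx hy; rewrite /zetaw -rmorphM; congr zetaqf; apply: val_inj.
by rewrite /= !val_admissible_part // QUo_stuffle.
Qed.

Lemma zetaw_tau s : admissible s -> zetaw (u (tau_word s)) = zetaw (u s).
Proof.
move=> hs; rewrite (zetaw_u hs) (zetaw_u (admissible_tau s)).
apply/zetaqf_eq; apply/asboolP; exists [:: (1, QUo_of_word hs)].
rewrite big_seq1 mul1r; congr (_ - _).
by apply: val_inj; rewrite /= lin_extU.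
Qed.

(** * Exponent tuples and compositions *)

Fixpoint tuples_of_sum (d z : nat) : seq (seq nat) :=
  if d is d'.+1 then
    [seq i :: c | i <- index_iota 0 z.+1, c <- tuples_of_sum d' (z - i)]
  else if z == 0%N then [:: [::]] else [::].

Lemma sum_tuples_of_sum (V : zmodType) d z (f : seq nat -> V) :
  \sum_(c <- tuples_of_sum d.+1 z) f c =
  \sum_(0 <= i < z.+1) \sum_(c <- tuples_of_sum d (z - i)) f (i :: c).
Proof. by rewrite big_allpairs_dep. Qed.

Lemma mem_tuples_of_sum d z c :
  (c \in tuples_of_sum d z) = (size c == d) && (sumn c == z).
Proof.
elim: d z c => [|d IH] z c.
  by rewrite /=; case: eqP => [->|z0]; case: c => [|i c] //=; rewrite ?inE //; lia.
rewrite -[tuples_of_sum _ _]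
  /[seq i :: c | i <- index_iota 0 z.+1, c <- tuples_of_sum d (z - i)].
apply/idP/idP => [/allpairsPdep[i [c' []]]|].
  rewrite mem_index_iota IH => iz /andP[/eqP sc /eqP cz] ->.
  by rewrite /= sc cz eqxx; apply/eqP; lia.
case: c => [|i c]; [by [] | case/andP=> sc /eqP cz; rewrite /= in sc cz].
apply/allpairsPdep; exists i, c.
rewrite mem_index_iota IH -eqSS sc; split=> //; first lia.
by apply/eqP; lia.
Qed.

Lemma tuples_of_sum_uniq d z : uniq (tuples_of_sum d z).
Proof.
elim: d z => [|d IH] z; first by rewrite /=; case: eqP.
by apply: allpairs_uniq_dep (iota_uniq _ _) _ _ => [i _|[i c] [j c'] _ _ [-> ->]].
Qed.

(** Duality reverses the order of the blocks, hence that of the exponents. *)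
Lemma perm_rev_tuples_of_sum d z :
  perm_eq [seq rev c | c <- tuples_of_sum d z] (tuples_of_sum d z).
Proof.
apply: uniq_perm (tuples_of_sum_uniq d z) _ => [|c].
  by rewrite map_inj_uniq ?tuples_of_sum_uniq //; apply: inv_inj revK.
rewrite -[c in LHS]revK mem_map; last exact: inv_inj revK.
by rewrite !mem_tuples_of_sum size_rev sumn_rev.
Qed.

(** The number of parts is bounded by [n], so that splitting off the first part
    stays a structural recursion.  Only parts that are merged with one of the [d]
    nonzero letters of a word matter below, so the bound [n = d] loses nothing. *)
Fixpoint compositions (n z : nat) : seq (seq nat) :=
  if z is 0%N then [:: [::]]
  else if n is n'.+1 then
    [seq i.+1 :: l | i <- index_iota 0 z, l <- compositions n' (z - i.+1)]
  else [::].

Lemma compositionsP n z l : l \in compositions n z ->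
  (all (leq 1) l) /\ sumn l = z.
Proof.
elim: n z l => [|n IH] [|z] l; rewrite ?inE //; try by move/eqP->.
rewrite -[compositions _ _]
  /[seq i.+1 :: l | i <- index_iota 0 z.+1, l <- compositions n (z.+1 - i.+1)].
case/allpairsPdep=> i [l' []]; rewrite mem_index_iota => iz /IH[h1 h2] ->.
by split=> //=; lia.
Qed.

Lemma dep_zero_positive l : all (leq 1) l -> dep l = size l /\ zero l = 0%N.
Proof.
by rewrite /dep /zero; elim: l => //= a l IH /andP[a0 /IH[-> ->]]; case: a a0.
Qed.

(** * Multiplying by all compositions of z *)

Definition mindep (e S n : nat) (w : seq nat) : bool :=
  [&& (e <= dep w)%N, sumn w == S & (zero w <= n)%N].

Lemma mindep_le e S n e' S' n' x : x \in supported (mindep e S n) ->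
  (e' <= e)%N -> S = S' -> (n <= n')%N -> x \in supported (mindep e' S' n').
Proof.
move=> hx le1 eS le2; apply: supported_sub hx => w; rewrite /mindep; lia.
Qed.

Lemma mindep_cons a e S n x : x \in supported (mindep e S n) ->
  u [:: a] * x \in supported (mindep ((a != 0%N) + e) (a + S) ((a == 0%N) + n)).
Proof.
by apply: supported_mulu => w; rewrite /mindep /dep /zero /=; lia.
Qed.

Definition comp_stuffle (n z : nat) (V : seq nat) : QU :=
  \sum_(l <- compositions n z) stuffle (u l) (u V).

Lemma comp_stuffle_mindep n z V :
  comp_stuffle n z V \in supported (mindep (dep V) (z + sumn V) (zero V)).
Proof.
rewrite /comp_stuffle big_seq; apply: rpred_sum => l /compositionsP[l0 sl].
apply: supported_sub (stuffle_stats l V) => w; rewrite /mindep /stuffle_stat.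
by have [_ ->] := dep_zero_positive l0; rewrite sl; lia.
Qed.

Lemma comp_stuffle0 n V : comp_stuffle n 0 V = u V.
Proof. by rewrite /comp_stuffle; case: n => [|n]; rewrite /= big_seq1 stuffle1l. Qed.

(** Decompose each composition at its first part i + 1.  In the stuffle recursion
    the terms starting with the letter i + 1 keep all letters of [v :: V] behind
    it, so their depth exceeds that of [v :: V]. *)
Lemma comp_stuffle_cons n z v V :
  comp_stuffle n.+1 z (v :: V) - (u [:: v] * comp_stuffle n.+1 z V
    + \sum_(0 <= i < z) u [:: (i.+1 + v)%N] * comp_stuffle n (z - i.+1) V)
  \in supported (mindep (dep (v :: V)).+1 (z + sumn (v :: V)) (zero (v :: V))).
Proof.
have [->|z0] := posnP z.
  by rewrite big_nil !comp_stuffle0 addr0 -u_cons subrr rpred0.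
have E Y : comp_stuffle n.+1 z Y =
    \sum_(0 <= i < z) \sum_(l <- compositions n (z - i.+1)) stuffle (u (i.+1 :: l)) (u Y).
  by rewrite /comp_stuffle; case: z z0 => // z _; rewrite big_allpairs_dep.
rewrite !E mulr_sumr -big_split /= -sumrB big_nat; apply: rpred_sum => i /= iz.
rewrite [X in X - _](_ : _ = u [:: i.+1] * comp_stuffle n (z - i.+1) (v :: V) +
   (u [:: v] * (\sum_(l <- compositions n (z - i.+1)) stuffle (u (i.+1 :: l)) (u V))
    + u [:: (i.+1 + v)%N] * comp_stuffle n (z - i.+1) V)); last first.
  rewrite /comp_stuffle !mulr_sumr -!big_split; apply: eq_bigr => l _ /=.
  by rewrite (u_cons i.+1) (u_cons v) stuffle_rec addrA.
rewrite addrK; apply: mindep_le (mindep_cons _ (comp_stuffle_mindep _ _ _)) _ _ _ => //=.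
lia.
Qed.

Lemma dep_cat s t : dep (s ++ t) = (dep s + dep t)%N.
Proof. exact: count_cat. Qed.

Lemma zero_cat s t : zero (s ++ t) = (zero s + zero t)%N.
Proof. exact: count_cat. Qed.

Lemma dep_nseq0 n : dep (nseq n 0%N) = 0%N.
Proof. by rewrite /dep count_nseq. Qed.

Lemma zero_nseq0 n : zero (nseq n 0%N) = n.
Proof. by rewrite /zero count_nseq mul1n. Qed.

Lemma sumn_nseq0 n : sumn (nseq n 0%N) = 0%N.
Proof. by rewrite sumn_nseq. Qed.

Definition word_statE :=
  (dep_cat, zero_cat, sumn_cat, dep_nseq0, zero_nseq0, sumn_nseq0).

Lemma word_of_blocks_stats b : all (fun p : nat * nat => 0 < p.1)%N b ->
  [/\ dep (word_of_blocks b) = size b,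
      zero (word_of_blocks b) = sumn [seq p.2 | p <- b] &
      sumn (word_of_blocks b) = sumn [seq p.1 | p <- b]].
Proof.
elim: b => [|[k z] b IH] // /andP[k0 /IH[e1 e2 e3]].
rewrite -[word_of_blocks _]/([:: k] ++ nseq z 0%N ++ word_of_blocks b).
rewrite !word_statE /= e1 e2 e3 /dep /zero /=; case: k k0 => //= k _.
by split; rewrite !addn0.
Qed.

(** In a block u_k u_0^z, duality exchanges k - 1 with z. *)
Lemma tau_word_stats s : admissible s ->
  [/\ dep (tau_word s) = dep s, (zero (tau_word s) + dep s = sumn s)%N &
      (sumn (tau_word s) = zero s + dep s)%N].
Proof.
case/admissible_blocks => b b0 ->; rewrite tau_wordE //.
have [-> -> ->] := word_of_blocks_stats b0.
have [|-> -> ->] := @word_of_blocks_stats (dual_blocks b).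
  by rewrite /dual_blocks all_rev all_map; apply/allP.
rewrite /dual_blocks !map_rev size_rev size_map !sumn_rev -!map_comp.
split=> //; elim: b b0 => [|[k z] b IH] //= /andP[k0 /IH]; lia.
Qed.

(** The dual of the word [rev k], if its letters are positive. *)
Definition unit_blocks (k : seq nat) : seq nat :=
  word_of_blocks [seq (1%N, x.-1) | x <- k].

(** The dual of the word in which the positive letters [rev k] are followed by [rev c]
    zeros, see [raised_blocks_rev]. *)
Definition raised_blocks (k c : seq nat) : seq nat :=
  word_of_blocks [seq (p.2.+1, p.1.-1) | p <- zip k c].

Lemma unit_blocks_stats k :
  [/\ dep (unit_blocks k) = size k & sumn (unit_blocks k) = size k].
Proof.
have [|-> _ ->] := @word_of_blocks_stats [seq (1%N, x.-1) | x <- k].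
  by rewrite all_map; apply/allP.
rewrite size_map -map_comp; split=> //.
by elim: k => //= x k ->.
Qed.

Lemma subr_mem_trans (S : zmodClosed QU) (x y z : QU) :
  x - y \in S -> y - z \in S -> x - z \in S.
Proof. by move=> h1 h2; rewrite -(subrK y x) -addrA rpredD. Qed.

(** A part merged with a letter 0 becomes a new nonzero letter, which raises the
    depth; so zeros can be pulled out of the product. *)
Lemma comp_stuffle_zeros n z m V :
  comp_stuffle n z (nseq m 0%N ++ V) - u (nseq m 0%N) * comp_stuffle n z V
  \in supported (mindep (dep V).+1 (z + sumn V) (m + zero V)).
Proof.
elim: m => [|m IH] /=; first by rewrite u_nil mul1r subrr rpred0.
set W := nseq m 0%N ++ V in IH *.
have [sV dV zV]: [/\ sumn W = sumn V, dep W = dep V & zero W = (m + zero V)%N].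
  by rewrite /W !word_statE.
apply: (@subr_mem_trans _ _ (u [:: 0%N] * comp_stuffle n z W)); last first.
  rewrite (u_cons 0%N (nseq m 0%N)) -mulrA -mulrBr.
  by apply: mindep_le (mindep_cons _ IH) _ _ _ => //=.
case: n IH => [|n] IH.
  case: (posnP z) => [->|z0]; first by rewrite !comp_stuffle0 -u_cons subrr rpred0.
  by rewrite /comp_stuffle; case: z z0 {IH} => // z _; rewrite !big_nil mulr0 subrr rpred0.
rewrite -[X in X - _](subrK (u [:: 0%N] * comp_stuffle n.+1 z W
    + \sum_(0 <= i < z) u [:: (i.+1 + 0)%N] * comp_stuffle n (z - i.+1) W)).
rewrite -addrA [X in _ + X]addrAC subrr add0r rpredD //.
  apply: mindep_le (comp_stuffle_cons _ _ _ _) _ _ _;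
    by rewrite -[0%N :: W]/(nseq m.+1 0%N ++ V) !word_statE.
rewrite big_nat; apply: rpred_sum => i /= iz.
apply: mindep_le (mindep_cons _ (comp_stuffle_mindep _ _ _)) _ _ _ => //=; lia.
Qed.

(** In minimal depth every part of the composition is added to a letter 1.  The
    exponent [c_i] is the part added to the i-th of these letters, or 0. *)
Lemma comp_stuffle_unit_blocks k n z : (size k <= n)%N ->
  comp_stuffle n z (unit_blocks k)
    - \sum_(c <- tuples_of_sum (size k) z) u (raised_blocks k c)
  \in supported (mindep (size k).+1 (z + size k) (zero (unit_blocks k))).
Proof.
elim: k n z => [|x k IH] n z.
  move=> _; rewrite -[X in X - _]subr0.
  case: (posnP z) => [->|z0].
    by rewrite comp_stuffle0 /= big_seq1 subr0 subrr rpred0.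
  rewrite /= (gtn_eqF z0) big_nil subr0 rpredB ?rpred0 // /comp_stuffle big_seq.
  apply: rpred_sum => l /compositionsP[l0 sl]; rewrite stuffle1r supported_u //.
  have [e1 e2] := dep_zero_positive l0; rewrite /mindep e1 e2 sl addn0 eqxx /= andbT.
  by case: l sl {l0 e1 e2} => // e; rewrite -e in z0.
case: n => // n; rewrite [size _]/= ltnS => kn.
pose V := nseq x.-1 0%N ++ unit_blocks k.
have -> : unit_blocks (x :: k) = 1%N :: V by [].
have [dk sk] := unit_blocks_stats k.
have [sV dV zV]: [/\ sumn V = size k, dep V = size k
    & zero V = (x.-1 + zero (unit_blocks k))%N].
  by rewrite /V !word_statE dk sk.
have IHV n' j : (size k <= n')%N -> comp_stuffle n' j V
    - \sum_(c <- tuples_of_sum (size k) j) u (nseq x.-1 0%N ++ raised_blocks k c)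
  \in supported (mindep (size k).+1 (j + size k) (zero V)).
  move=> kn'; apply: (@subr_mem_trans _ _ (u (nseq x.-1 0%N) * comp_stuffle n' j (unit_blocks k))).
    by apply: mindep_le (comp_stuffle_zeros _ _ _ _) _ _ _; rewrite ?dk ?sk ?zV.
  rewrite (eq_bigr (fun c => u (nseq x.-1 0%N) * u (raised_blocks k c))); last first.
    by move=> c _; rewrite u_cat.
  rewrite -mulr_sumr -mulrBr; apply: supported_mulu (IH _ j kn') => w.
  by rewrite /mindep zV !word_statE; lia.
rewrite -/V.
apply: subr_mem_trans.
  apply: mindep_le (comp_stuffle_cons _ _ _ _) _ _ _.
  - by rewrite -[dep _]/(dep V).+1 dV.
  - by rewrite -[sumn _]/(sumn V).+1 sV.
  - by [].
rewrite sum_tuples_of_sum big_nat_recl // subn0.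
rewrite opprD addrACA rpredD //.
  rewrite (eq_bigr (fun c => u [:: 1%N] * u (nseq x.-1 0%N ++ raised_blocks k c))); last first.
    by move=> c _; rewrite -u_cons.
  rewrite -mulr_sumr -mulrBr.
  by apply: mindep_le (mindep_cons _ (IHV _ z (leqW kn))) _ _ _ => //=; lia.
rewrite -sumrB big_nat; apply: rpred_sum => i /= iz.
rewrite (eq_bigr (fun c => u [:: (i.+1 + 1)%N] *
    u (nseq x.-1 0%N ++ raised_blocks k c))); last first.
  by move=> c _; rewrite -u_cons addn1.
rewrite -mulr_sumr -mulrBr.
by apply: mindep_le (mindep_cons _ (IHV _ (z - i.+1)%N kn)) _ _ _; rewrite ?addn1 //=; lia.
Qed.

(** * Distributing zeros among positive letters *)

Definition few (z d S : nat) (w : seq nat) : bool :=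
  [&& (zero w < z)%N, (dep w <= d)%N & sumn w == S].

Lemma stuffle_cons_zeros b B z : (0 < b)%N -> all (leq 1) B ->
  stuffle (u (b :: B)) (u (nseq z 0%N))
   - \sum_(0 <= i < z.+1) u (nseq i 0%N ++ [:: b]) * stuffle (u B) (u (nseq (z - i) 0%N))
  \in supported (few z (size B).+1 (b + sumn B)).
Proof.
move=> b0 B0; have [dB zB] := dep_zero_positive B0.
elim: z => [|z IH].
  by rewrite big_nat1 /= !stuffle1r -u_cons subrr rpred0.
rewrite big_nat_recl // [nseq z.+1 _]/= (u_cons b B) (u_cons 0%N (nseq z 0%N)).
rewrite stuffle_rec -!u_cons addn0 -[X in X - _]addrA [X in X - _]addrC addrKA addrAC.
rewrite rpredD //.
  rewrite (eq_bigr (fun i => u [:: 0%N] * (u (nseq i 0%N ++ [:: b]) *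
    stuffle (u B) (u (nseq (z - i) 0%N))))); last first.
    by move=> i _; rewrite mulrA -u_cons.
  rewrite -mulr_sumr -mulrBr; apply: supported_mulu IH => w.
  by rewrite /few /zero /dep /=; lia.
apply: supported_mulu (stuffle_stats _ _) => w.
rewrite /few /stuffle_stat dB zB dep_nseq0 zero_nseq0 sumn_nseq0 /zero /dep /=; lia.
Qed.

(** In a stuffle product, zeros are placed before, between and behind the letters
    of [B], or absorbed by such a letter; [head 0 c] counts those placed before
    [B]. *)
Lemma stuffle_zeros B z : all (leq 1) B ->
  stuffle (u B) (u (nseq z 0%N))
   - \sum_(c <- tuples_of_sum (size B).+1 z)
       u (nseq (head 0%N c) 0%N ++ word_of_blocks (zip B (behead c)))
  \in supported (few z (size B) (sumn B)).
Proof.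
elim: B z => [|b B IH] z.
  move=> _; rewrite stuffle1l sum_tuples_of_sum big_nat_recr //= subnn big_seq1.
  rewrite big1_seq ?add0r ?cats0 ?subrr ?rpred0 // => i; rewrite mem_index_iota => /= iz.
  by rewrite subn_eq0 leqNgt iz big_nil.
case/andP=> b0 B0; apply: subr_mem_trans (stuffle_cons_zeros z b0 B0) _.
rewrite sum_tuples_of_sum -sumrB big_nat; apply: rpred_sum => i _.
rewrite (eq_big_seq (fun c => u (nseq i 0%N ++ [:: b]) *
   u (nseq (head 0%N c) 0%N ++ word_of_blocks (zip B (behead c))))); last first.
  move=> c; rewrite mem_tuples_of_sum -u_cat -catA; case: c => [|j c] // _.
rewrite -mulr_sumr -mulrBr; apply: supported_mulu (IH _ B0) => w.
rewrite /few !word_statE /zero /dep /=; lia.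
Qed.

(** * The filtrations *)

Definition subspace (V : lmodType rat) (S : set V) : Prop :=
  S 0 /\ forall a x y, S x -> S y -> S (a *: x + y).

Lemma subspace_add (V : lmodType rat) (S : set V) x y :
  subspace S -> S x -> S y -> S (x + y).
Proof. by move=> [_ SD] Sx Sy; rewrite -[x]scale1r; apply: SD. Qed.

Lemma subspace_sub (V : lmodType rat) (S : set V) x y :
  subspace S -> S x -> S y -> S (x - y).
Proof. by move=> [_ SD] Sx Sy; rewrite addrC -scaleN1r; apply: SD. Qed.

Lemma subspace_big (V : lmodType rat) (S : set V) (I : eqType) (r : seq I) (F : I -> V) :
  subspace S -> (forall i, i \in r -> S (F i)) -> S (\sum_(i <- r) F i).
Proof.
move=> Ssub SF; rewrite big_seq; elim/big_rec: _ => [|i x ir Sx]; first by case: Ssub.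
by apply: subspace_add => //; apply: SF.
Qed.

Lemma subspace_span (V : lmodType rat) (S : set V) : subspace (span S).
Proof.
split=> [|a x y [r Sr ->] [q Sq ->]]; first by exists [::] => //; rewrite big_nil.
exists ([seq (a * p.1, p.2) | p <- r] ++ q).
  by move=> p; rewrite mem_cat => /orP[/mapP[p' /Sr S' ->] | /Sq].
rewrite big_cat big_map scaler_sumr; congr (_ + _).
by apply: eq_bigr => p _; rewrite scalerA.
Qed.

Lemma subspace_FilZDW z d w : subspace (FilZDW z d w).
Proof.
have [Z0 ZD] := subspace_span [set x | exists s (hs : admissible s),
  (zero s)%:Z <= z /\ x = zetaqf (QUo_of_word hs)].
have [D0 DD] := subspace_span [set x | exists s (hs : admissible s),
  (dep s)%:Z <= d /\ x = zetaqf (QUo_of_word hs)].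
have [W0 WD] := subspace_span [set x | exists s (hs : admissible s),
  (wt s)%:Z <= w /\ x = zetaqf (QUo_of_word hs)].
split=> [|a x y [[Zx Dx] Wx] [[Zy Dy] Wy]]; first by [].
by split; [split|]; [apply: ZD | apply: DD | apply: WD].
Qed.

Lemma subspace_sum (V : lmodType rat) m n (F : nat -> set V) :
  (forall s, subspace (F s)) -> subspace (sum_subspaces m n F).
Proof.
move=> Fsub; split=> [|a x y [x' Fx ->] [y' Fy ->]].
  by exists (fun=> 0) => [s _|]; [case: (Fsub s) | rewrite big1].
exists (fun s => a *: x' s + y' s) => [s ms|]; last by rewrite scaler_sumr big_split.
by have [_ FD] := Fsub s; apply: FD; [apply: Fx | apply: Fy].
Qed.

Lemma sum_subspaces_term (V : lmodType rat) m n (F : nat -> set V) t x :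
  (forall s, subspace (F s)) -> (m <= t <= n)%N -> F t x -> sum_subspaces m n F x.
Proof.
move=> Fsub mtn Fx; exists (fun s => if s == t then x else 0) => [s _|].
  by case: eqP => [->|_] //; case: (Fsub s).
by rewrite -big_mkcond big_nat1_eq ltnS mtn.
Qed.

Lemma fil_word f n s : admissible s -> (f s)%:Z <= n -> fil f n (zetaw (u s)).
Proof.
move=> hs hf; exists [:: (1, zetaw (u s))]; last by rewrite big_seq1 scale1r.
by move=> p; rewrite inE => /eqP ->; exists s, hs; split=> //; apply: zetaw_u.
Qed.

Lemma fil_le f n n' x : fil f n x -> n <= n' -> fil f n' x.
Proof.
move=> [r hr ->] nn'; exists r => // p /hr[s [hs [fs ->]]].
by exists s, hs; split=> //; apply: le_trans nn'.
Qed.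

Lemma zetaw_supported (S : set Zqf) (P : pred (seq nat)) x : subspace S ->
  (forall w, P w -> S (zetaw (u w))) -> x \in supported P -> S (zetaw x).
Proof.
move=> [S0 SD] SP; move: x; apply: supported_ind => //.
- by rewrite linear0.
- by move=> a x y Sx Sy; rewrite linearP; apply: SD.
Qed.

(** The three filtrations are stated as spans of different families of words, so
    that the intersection need not be spanned by words.  Multiplication by a
    fixed word is therefore handled for each of them separately. *)
Lemma fil_mul f n m t x : admissible t ->
  (forall s, stuffle (u s) (u t) \in supported (fun w => f w <= f s + m)%N) ->
  fil f n x -> fil f (n + m%:Z) (x * zetaw (u t)).
Proof.
move=> ht hf [r hr ->]; rewrite mulr_suml.
apply: subspace_big => [|p /hr[s [hs [fs ->]]]]; first exact: subspace_span.
have [F0 FD] : subspace (fil f (n + m%:Z)) by exact: subspace_span.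
rewrite -scalerAl -[_ *: _]addr0.
apply: FD => //; rewrite -zetaw_u -zetaw_stuffle ?QUo_u //.
have h := supported_and (QUo_stuffle (QUo_u hs) (QUo_u ht)) (hf s).
apply: zetaw_supported h => [|w /andP[aw fw]]; first exact: subspace_span.
by apply: fil_word => //; lia.
Qed.

Lemma admissible_positive B : all (leq 1) B -> admissible B.
Proof. by case: B => [|[|b] B]. Qed.

Lemma FilZDW_mul z d w B x : all (leq 1) B -> FilZDW z d w x ->
  FilZDW z (d + (size B)%:Z) (w + (sumn B)%:Z) (x * zetaw (u B)).
Proof.
move=> B0 [[Zx Dx] Wx]; have [dB zB] := dep_zero_positive B0.
have aB := admissible_positive B0.
split; [split|].
- rewrite -[z]addr0; apply: (fil_mul (m := 0)) Zx => // s.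
  by apply: supported_sub (stuffle_stats s B) => v; rewrite /stuffle_stat; lia.
- apply: fil_mul Dx => // s.
  by apply: supported_sub (stuffle_stats s B) => v; rewrite /stuffle_stat; lia.
- apply: fil_mul Wx => // s.
  by apply: supported_sub (stuffle_stats s B) => v; rewrite /stuffle_stat /wt; lia.
Qed.

Definition reduced (z d w : nat) : set Zqf :=
  sum_subspaces 1 z (fun s => FilZDW (z%:Z - s%:Z) (d%:Z + s%:Z) w%:Z).

Lemma subspace_reduced z d w : subspace (reduced z d w).
Proof. by apply: subspace_sum => s; apply: subspace_FilZDW. Qed.

Lemma reduced_word z d w t s : admissible s -> (1 <= t <= z)%N ->
  (zero s + t <= z)%N -> (dep s <= d + t)%N -> (wt s <= w)%N ->
  reduced z d w (zetaw (u s)).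
Proof.
move=> hs tz h1 h2 h3; apply: (sum_subspaces_term _ tz) => [s'|].
  exact: subspace_FilZDW.
by split; [split|]; apply: fil_word => //; lia.
Qed.

Lemma reduced_le z d d' w x : reduced z d w x -> (d <= d')%N -> reduced z d' w x.
Proof.
move=> [y hy ->] dd'; exists y => // s /hy[[hZ hD] hW]; split=> //; split=> //.
by apply: fil_le hD _; lia.
Qed.

Lemma reduced_mul z d w B x : all (leq 1) B -> reduced z d w x ->
  reduced z (d + size B) (w + sumn B) (x * zetaw (u B)).
Proof.
move=> B0 [y hy ->]; exists (fun s => y s * zetaw (u B)); last by rewrite mulr_suml.
move=> s /hy /(FilZDW_mul B0).
by rewrite !PoszD addrAC.
Qed.

(** * One prefix letter, all other letters in the first factor *)

Lemma admissible_raised_blocks k c : admissible (raised_blocks k c).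
Proof. by case: k c => [|x k] [|i c]. Qed.

Lemma raised_blocks_rev k c : all (leq 1) k -> size c = size k ->
  raised_blocks (rev k) (rev c) = tau_word (word_of_blocks (zip k c)).
Proof.
move=> k0 sc; rewrite tau_wordE; last first.
  elim: k c k0 sc => [|x k IH] [|i c] //= /andP[x0 k0] [sc].
  by rewrite x0; apply: IH.
by rewrite /raised_blocks /dual_blocks -rev_zip // map_rev.
Qed.

Lemma unit_blocks_rev k : all (leq 1) k -> unit_blocks (rev k) = tau_word k.
Proof.
move=> k0; have {2}-> : k = word_of_blocks [seq (x, 0%N) | x <- k].
  by elim: k {k0} => //= x k {1}->.
rewrite tau_wordE; last by rewrite all_map.
by rewrite /unit_blocks /dual_blocks -map_comp map_rev.
Qed.

Lemma zetaw_sum (I : Type) (r : seq I) (F : I -> QU) :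
  zetaw (\sum_(i <- r) F i) = \sum_(i <- r) zetaw (F i).
Proof. exact: linear_sum. Qed.

Section Insertion.
Variables (z a : nat) (B : seq nat).
Hypotheses (z_gt0 : (0 < z)%N) (a_gt0 : (0 < a)%N) (B_gt0 : all (leq 1) B).
Let k := a :: B.
Let d := size k.
Let good := reduced z d (sumn k + z).

Let k_gt0 : all (leq 1) k. Proof. by rewrite /= a_gt0. Qed.
Let good_sub : subspace good. Proof. exact: subspace_reduced. Qed.

(** As [unit_blocks (rev k)] is the dual of [k], duality in both factors
    turns the product with a composition [l] into that of [tau_word l] with the
    zero-free word [k].  The former has [z - size l] zeros and depth [size l]. *)
Lemma comp_stuffle_unit_blocks_reduced :
  good (zetaw (comp_stuffle d z (unit_blocks (rev k)))).
Proof.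
rewrite /comp_stuffle zetaw_sum; apply: subspace_big => // l /compositionsP[l0 sl].
have al := admissible_positive l0; have ak := admissible_positive k_gt0.
rewrite unit_blocks_rev // zetaw_stuffle ?QUo_u ?admissible_tau // zetaw_tau // -(zetaw_tau al).
rewrite /good addnC -[d]add0n; apply: reduced_mul => //.
have [e1 e2 e3] := tau_word_stats al; have [dl zl] := dep_zero_positive l0.
have dl0 : (0 < dep l)%N.
  by rewrite dl lt0n size_eq0; apply: contraTneq z_gt0 => l_nil; rewrite -sl l_nil.
by apply: (@reduced_word _ _ _ (dep l)); rewrite ?admissible_tau // /wt; lia.
Qed.

(** The difference from the previous sum consists of words [w] of depth [> d]
    with letter sum [z + d].  Their duals have [z - (dep w - d)] zeros, so they
    lie in the term [s = dep w - d] of the sum of filtrations. *)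
Lemma raised_blocks_reduced :
  good (zetaw (\sum_(c <- tuples_of_sum d z) u (raised_blocks (rev k) c))).
Proof.
set R := \sum_(c <- _) _; rewrite -[R](subKr (comp_stuffle d z (unit_blocks (rev k)))).
rewrite linearB; apply: subspace_sub => //; first exact: comp_stuffle_unit_blocks_reduced.
have ak := admissible_positive k_gt0; have [e1 e2 e3] := tau_word_stats ak.
have [dk zk] := dep_zero_positive k_gt0.
have hR : comp_stuffle d z (unit_blocks (rev k)) - R \in QUo_pred.
  rewrite rpredB //; last by apply: rpred_sum => c _; rewrite QUo_u ?admissible_raised_blocks.
  rewrite /comp_stuffle big_seq; apply: rpred_sum => l /compositionsP[l0 _].
  by rewrite QUo_stuffle // QUo_u ?unit_blocks_rev ?admissible_tau ?admissible_positive.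
have := @comp_stuffle_unit_blocks (rev k) d z; rewrite size_rev leqnn => /(_ isT) hk.
apply: zetaw_supported (supported_and hR hk) => // w /andP[aw].
rewrite /mindep unit_blocks_rev // => /and3P[h1 /eqP h2 h3].
have [f1 f2 f3] := tau_word_stats aw; rewrite -(zetaw_tau aw).
rewrite -/d in h1 h2 dk; rewrite /good.
by apply: (@reduced_word _ _ _ (dep w - d)); rewrite ?admissible_tau // /wt; lia.
Qed.

Lemma insert_zeros_reduced :
  good (zetaw (\sum_(c <- tuples_of_sum d z) u (word_of_blocks (zip k c)))).
Proof.
suff -> : zetaw (\sum_(c <- tuples_of_sum d z) u (word_of_blocks (zip k c))) =
  zetaw (\sum_(c <- tuples_of_sum d z) u (raised_blocks (rev k) c)).
  exact: raised_blocks_reduced.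
rewrite -[in RHS](perm_big _ (perm_rev_tuples_of_sum d z)) big_map !zetaw_sum.
apply: eq_big_seq => c; rewrite mem_tuples_of_sum => /andP[/eqP sc _].
rewrite raised_blocks_rev // zetaw_tau //.
by case: c {sc} => [|i c] //; rewrite /admissible /= -lt0n.
Qed.

(** Words in which a zero was absorbed have fewer than [z] zeros and depth at
    most [d], so they lie in the term [s = 1]. *)
Lemma stuffle_zeros_reduced :
  good (zetaw (u [:: a] * stuffle (u B) (u (nseq z 0%N)))).
Proof.
rewrite -[X in zetaw X](subrK (\sum_(c <- tuples_of_sum d z) u (word_of_blocks (zip k c)))).
rewrite linearD; apply: subspace_add => //; last exact: insert_zeros_reduced.
rewrite (eq_big_seq (fun c => u [:: a] *
    u (nseq (head 0%N c) 0%N ++ word_of_blocks (zip B (behead c))))); last first.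
  by move=> c; rewrite mem_tuples_of_sum -u_cat; case: c.
rewrite -mulr_sumr -mulrBr.
(* The prefix [a > 0] is what makes the error words admissible. *)
pose P w := admissible w && few z d (sumn k) w.
apply: (@zetaw_supported _ P) => // [w /andP[aw /and3P[h1 h2 /eqP h3]]|].
  by apply: (@reduced_word _ _ _ 1) => //; rewrite /wt; lia.
apply: supported_mulu (stuffle_zeros z B_gt0) => w.
rewrite /P /few /admissible /zero /dep /d /k /=; lia.
Qed.
End Insertion.

(** * Induction on the depth *)

Definition split_stuffle (z : nat) (p B D : seq nat) : QU :=
  u p * stuffle (u B) (u (D ++ nseq z 0%N)).

Lemma split_stuffle_rec z p b B a D :
  split_stuffle z p (b :: B) (a :: D) =
    split_stuffle z (rcons p b) B (a :: D) + split_stuffle z (rcons p a) (b :: B) D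
    + split_stuffle z (rcons p (b + a)) B D.
Proof.
rewrite /split_stuffle -!cats1 !(u_cat p) -!mulrA -!mulrDr; congr (_ * _).
by rewrite cat_cons (u_cons b B) (u_cons a (D ++ _)) stuffle_rec -!u_cons.
Qed.

Lemma split_stuffle_nil z p D : split_stuffle z p [::] D = split_stuffle z (p ++ D) [::] [::].
Proof. by rewrite /split_stuffle !stuffle1l -!u_cat catA. Qed.

(** [step] is the recursion modulo the merged term: it exchanges the two ways of
    lengthening the prefix by one letter.  [product] gives the empty prefix and
    [single] the prefixes of one letter. *)
Lemma split_stuffle_reduced z : (0 < z)%N -> forall d w (p B D : seq nat),
  p != [::] -> all (leq 1) (p ++ B ++ D) ->
  size (p ++ B ++ D) = d -> sumn (p ++ B ++ D) = w ->
  reduced z d (w + z) (zetaw (split_stuffle z p B D)).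
Proof.
move=> z0 d; elim/ltn_ind: d => d IHd w.
pose good x := reduced z d (w + z) (zetaw x).
pose valid p B D := [&& all (leq 1) (p ++ B ++ D), size (p ++ B ++ D) == d
  & sumn (p ++ B ++ D) == w].
have good_sub : subspace (reduced z d (w + z)) by exact: subspace_reduced.
have merged p b B a D : valid p (b :: B) (a :: D) ->
    good (split_stuffle z (rcons p (b + a)%N) B D).
  rewrite /valid !all_cat !size_cat !sumn_cat /= => hv.
  (* Merging keeps the letter sum and lowers the depth by one. *)
  apply: (@reduced_le _ d.-1); last exact: leq_pred.
  apply: IHd; rewrite ?all_cat ?size_cat ?sumn_cat ?all_rcons ?size_rcons ?sumn_rcons; try lia.
  by case: (p).
have step p b B a D : valid p (b :: B) (a :: D) ->
    good (split_stuffle z p (b :: B) (a :: D)) ->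
    good (split_stuffle z (rcons p b) B (a :: D)) <->
    good (split_stuffle z (rcons p a) (b :: B) D).
  move=> hv; have := merged _ _ _ _ _ hv; rewrite /good split_stuffle_rec !linearD => hM hX.
  have := subspace_sub good_sub hX hM; rewrite addrK => hXM.
  split=> [hY|hW].
    by have := subspace_sub good_sub hXM hY; rewrite addrAC subrr add0r.
  by have := subspace_sub good_sub hXM hW; rewrite addrK.
have product (B D : seq nat) : B != [::] -> D != [::] -> valid [::] B D ->
    good (split_stuffle z [::] B D).
  move=> Bn Dn /and3P[]; rewrite !cat0s all_cat size_cat sumn_cat => /andP[B0 D0] /eqP sd /eqP sw.
  have := IHd (size D) _ (sumn D) D [::] [::] Dn; rewrite !cats0 => IH.
  have {}IH := IH _ D0 erefl erefl.
  have sB : (0 < size B)%N by case: (B) Bn.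
  have := reduced_mul B0 (IH ltac:(lia)).
  rewrite /good /split_stuffle stuffle1l -u_cat u_nil mul1r -zetaw_stuffle.
  - by rewrite stuffleC -sd -sw; congr (reduced _ _ _ _); lia.
  - by rewrite QUo_u //; case: (D) Dn D0 => [|[]].
  - by rewrite QUo_u // admissible_positive.
have single a B D : valid [:: a] B D -> good (split_stuffle z [:: a] B D).
  elim: D a B => [|a' D IHD] a B hv.
    move: hv; rewrite /valid /good cats0 => /and3P[/andP[a0 B0] /eqP <- /eqP <-].
    exact: stuffle_zeros_reduced.
  have hv' : valid [::] (a :: B) (a' :: D) by [].
  apply/(step [::] a B a' D hv'); first exact: product.
  apply: IHD; move: hv; rewrite /valid !all_cat !size_cat !sumn_cat /=; lia.
move=> p B D p0 h1 h2 h3.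
have : valid p B D by rewrite /valid h1 h2 h3 !eqxx.
rewrite -/(good _); elim/last_ind: p p0 B D {h1 h2 h3} => // p a IHp _ B D.
have [->|p0] := eqVneq p [::]; first exact: single.
elim: B a D => [|b B IHB] a D hv.
  rewrite split_stuffle_nil cat_rcons -split_stuffle_nil; apply: IHp => //.
  by move: hv; rewrite /valid cat_rcons.
have hv' : valid p (b :: B) (a :: D).
  by move: hv; rewrite /valid !all_cat !size_cat !sumn_cat all_rcons size_rcons sumn_rcons /=; lia.
apply/(step p b B a D hv'); first exact: IHp.
apply: IHB; move: hv; rewrite /valid !all_cat !size_cat !sumn_cat.
rewrite !all_rcons !size_rcons !sumn_rcons /=; lia.
Qed.

Theorem theorem6 (z d : nat) (hz : (0 < z)%N) (hd : (0 < d)%N)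
  (k : d.-tuple nat) (hk : forall i : 'I_d, (0 < tnth k i)%N)
  (j1 j2 : nat) (hj1 : (1 <= j1)%N) (hj12 : (j1 <= j2)%N) (hj2 : (j2 <= d)%N) :
  exists2 x : QUo,
    \val x = u (take j1 k) *
      stuffle (u (drop j1 (take j2 k))) (u (drop j2 k ++ nseq z 0%N))
  & sum_subspaces 1 z
      (fun s => FilZDW (z%:Z - s%:Z) (d%:Z + s%:Z) (sumn k + z)%N%:Z)
      (zetaqf x).
Proof.
have k_gt0 : all (leq 1) k by apply/all_tnthP.
have ksplit : take j1 k ++ drop j1 (take j2 k) ++ drop j2 k = k.
  by rewrite catA -{1}(take_takel k hj12) !cat_take_drop.
set p := take j1 k in ksplit *; set B := drop j1 _ in ksplit *.
set D := drop j2 k in ksplit *.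
have p0 : p != [::] by rewrite -size_eq0 size_takel ?size_tuple -?lt0n // (leq_trans hj12).
have adm : split_stuffle z p B D \in QUo_pred.
  have : all (leq 1) p by move: k_gt0; rewrite -ksplit all_cat => /andP[].
  rewrite /split_stuffle; case: (p) p0 => // a p' _ /andP[a0 _].
  by rewrite u_cons -mulrA QUo_ucat // -lt0n.
exists (admissible_part (split_stuffle z p B D)); first exact: val_admissible_part.
by apply: split_stuffle_reduced => //; rewrite ksplit ?size_tuple.
Qed.
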